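(* There is a compact subset of $\mathbb{R}$ which has Lebesgue measure zero and is meager, but which is not a countable union of closed Haar-countable subsets of $\mathbb{R}$; moreover, it cannot be covered by countably many closed Haar-countable subsets of $\mathbb{R}$.
   Context: A Cantor set is a homeomorphic copy of $2^\omega$. A set $A\subseteq\mathbb{R}$ is Haar-countable if there are a Borel set $B\subseteq\mathbb{R}$ with $A\subseteq B$ and a Cantor set $C\subseteq\mathbb{R}$ such that $(C+x)\cap B$ is at most countable for all $x\in\mathbb{R}$. *)

(* Defs.v *)
From mathcomp Require Import all_boot all_order all_algebra.
From mathcomp Require Import all_classical all_reals all_analysis.

Set Implicit Arguments.
Unset Strict Implicit.
Unset Printing Implicit Defensive.

Import Order.TTheory GRing.Theory Num.Theory.
Import numFieldNormedType.Exports.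

Local Open Scope classical_set_scope.
Local Open Scope ring_scope.

Definition countable_union_of (T : Type) (P : set (set T)) (A : set T) : Prop :=
  exists FF : set (set T),
    [/\ countable FF, FF `<=` P & A = \bigcup_(X in FF) X].

Definition countable_cover_by (T : Type) (P : set (set T)) (A : set T) : Prop :=
  exists FF : set (set T),
    [/\ countable FF, FF `<=` P & A `<=` \bigcup_(X in FF) X].

Definition nowhere_dense (T : topologicalType) (A : set T) : Prop :=
  (closure A)° = set0.

Definition meager (T : topologicalType) (A : set T) : Prop :=
  countable_union_of (@nowhere_dense T) A.

(* [f] is a homeomorphism from 2^omega onto the subspace [C], and the
   restriction of [g] to [C] is its inverse; values of [g] off [C] are
   irrelevant. *)
Definition cantor_set (T : topologicalType) (C : set T) : Prop :=
  exists (f : cantor_space -> T) (g : T -> cantor_space),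
    [/\ continuous f, {within C, continuous g}, range f = C & cancel f g].

(* [measurable] on [R] is the Borel sigma-algebra ([RGenOpens.measurableE]). *)
Definition haar_countable (R : realType) (A : set R) : Prop :=
  exists B C : set R,
    [/\ measurable B, A `<=` B, cantor_set C &
        forall x : R, countable ([set c + x | c in C] `&` B)].

(* Main.v *)
(** The Erdős–Kakutani set [K], of all sums [\sum_(n >= 2) d_n / n!] with
    [0 <= d_n <= n - 2], is compact, and it is null since it is covered by
    [(n-1)!] intervals of length [1 / n!].  Following Elekes and Steprāns, every
    Cantor set [C] contains a Cantor set [Q] so sparse that its points show only
    few digits at place [n!], for every [n]; one can then choose the digits of a
    translation [t] one after the other so that [Q + t] avoids the forbidden
    digit [n - 1] at every place and lands in a prescribed portion of [K].  So
    no nonempty portion of [K] is Haar-countable, whereas by the Baire category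
    theorem one of the sets of a countable closed cover of [K] contains a
    nonempty portion. *)

Require Import Defs.
From mathcomp Require Import all_boot all_order all_algebra.
From mathcomp Require Import all_classical all_reals all_analysis.
From mathcomp Require Import zify ring lra.

Set Implicit Arguments.
Unset Strict Implicit.
Unset Printing Implicit Defensive.

Import Order.TTheory GRing.Theory Num.Theory.
Import numFieldNormedType.Exports.

Local Open Scope classical_set_scope.
Local Open Scope ring_scope.

(** * Finite unions of closed grid intervals *)

Definition grid_cells (R : realType) (d : R) (s : seq nat) : set R :=
  [set y | exists2 a : nat, a \in s & a%:R <= d * y <= a.+1%:R].

Lemma grid_cells_cons (R : realType) (d : R) (a : nat) (s : seq nat) : 0 < d ->
  grid_cells d (a :: s) = `[a%:R / d, a.+1%:R / d] `|` grid_cells d s.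
Proof.
move=> d0; apply/seteqP; split=> y /=.
  move=> [b]; rewrite inE => /orP[/eqP -> h|bs h]; last by right; exists b.
  by left; rewrite in_itv /= ler_pdivrMr // ler_pdivlMr // mulrC.
move=> [|[b bs h]]; last by exists b; rewrite // inE bs orbT.
rewrite in_itv /= ler_pdivrMr // ler_pdivlMr // mulrC => h.
by exists a; rewrite // mem_head.
Qed.

Lemma closed_grid_cells (R : realType) (d : R) (s : seq nat) :
  0 < d -> closed (grid_cells d s).
Proof.
move=> d0; elim: s => [|a s IH].
  rewrite [grid_cells _ _](_ : _ = set0); first exact: closed0.
  by apply/seteqP; split=> y // [].
rewrite grid_cells_cons //; apply: closedU => //; exact: itv_closed.
Qed.

Lemma lebesgue_measure_grid_cells (R : realType) (d : R) (s : seq nat) :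
  0 < d -> (lebesgue_measure (grid_cells d s) <= ((size s)%:R / d)%:E)%E.
Proof.
move=> d0; elim: s => [|a s IH].
  rewrite [grid_cells _ _](_ : _ = set0) ?measure0 ?mul0r //.
  by apply/seteqP; split=> y // [].
rewrite grid_cells_cons //.
have mG : measurable (grid_cells d s).
  by apply: measurable_realfun.closed_measurable; exact: closed_grid_cells.
have mI : measurable (`[a%:R / d, a.+1%:R / d]%classic : set R).
  exact: measurable_itv.
have lI : lebesgue_measure (`[a%:R / d, a.+1%:R / d]%classic : set R) = d^-1%:E.
  rewrite lebesgue_measure_itv /= lte_fin ltr_pM2r ?invr_gt0 // ltr_nat ltnSn.
  by rewrite -EFinD -mulrBl -[a.+1]addn1 natrD addrAC subrr add0r mul1r.
apply: le_trans (measureU2 (@lebesgue_measure R) mI mG) _.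
have -> : (size (a :: s))%:R / d = d^-1 + (size s)%:R / d.
  by rewrite /= -natr1 mulrDl mul1r addrC.
by rewrite EFinD; apply: leeD; rewrite // -lI.
Qed.

(** * The Erdős-Kakutani set is compact, null and meager *)

(* Step [k] works at scale [1 / (k+1)!]: the digit at place [(k+2)!] ranges
   over [0..k], so that [k+1] is the one digit left out. *)
Fixpoint ek_cells (k : nat) : seq nat :=
  if k is k'.+1
  then [seq (k'.+2 * a + j)%N | a <- ek_cells k', j <- iota 0 k'.+1]
  else [:: 0%N].

Definition erdos_kakutani (R : realType) : set R :=
  \bigcap_k grid_cells ((k.+1)`!)%:R (ek_cells k).

Lemma size_ek_cells (k : nat) : size (ek_cells k) = k`!.
Proof.
elim: k => // k IH; apply: etrans (size_allpairs _ _ _) _.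
by rewrite IH size_iota factS mulnC.
Qed.

Lemma mem_ek_cells (k a j : nat) : a \in ek_cells k -> (j < k.+1)%N ->
  (k.+2 * a + j)%N \in ek_cells k.+1.
Proof. by move=> ak jk; apply: allpairs_f => //; rewrite mem_iota. Qed.

Lemma fact_gt0r (R : realType) (k : nat) : 0 < (k`!)%:R :> R.
Proof. by rewrite ltr0n fact_gt0. Qed.

Lemma closed_erdos_kakutani (R : realType) : closed (@erdos_kakutani R).
Proof.
by apply: closed_bigI => k _; apply: closed_grid_cells; exact: fact_gt0r.
Qed.

Lemma compact_erdos_kakutani (R : realType) : compact (@erdos_kakutani R).
Proof.
rewrite [@erdos_kakutani R](_ : _ = `[0, 1]%classic `&` @erdos_kakutani R).
  apply: compact_closedI; first exact: segment_compact.
  exact: closed_erdos_kakutani.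
apply/seteqP; split=> y //=; last by case.
move=> yK; split=> //; have [a] := yK 0%N I.
by rewrite inE => /eqP ->; rewrite mul1r in_itv.
Qed.

Lemma null_erdos_kakutani (R : realType) :
  lebesgue_measure (@erdos_kakutani R) = 0%E.
Proof.
apply/eqP; rewrite eq_le measure_ge0 andbT; apply/lee_addgt0Pr => e e0.
rewrite add0e.
have [k] := ltr_add_invr e0; rewrite add0r => ke.
have d0 := fact_gt0r R k.+1.
have KG : @erdos_kakutani R `<=` grid_cells ((k.+1)`!)%:R (ek_cells k).
  by move=> y; exact.
have KGm : (lebesgue_measure (@erdos_kakutani R) <=
    lebesgue_measure (grid_cells (k.+1`!%:R : R) (ek_cells k)))%E.
  apply: (@le_measure _ R _ (@lebesgue_measure R)) => //; rewrite inE.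
    apply: measurable_realfun.closed_measurable; exact: closed_erdos_kakutani.
  by apply: measurable_realfun.closed_measurable; exact: closed_grid_cells.
apply: (le_trans KGm).
apply: le_trans (lebesgue_measure_grid_cells _ d0) _.
(* The bound is k! / (k+1)! = 1 / (k+1), which is below [e] by the choice of [k]. *)
rewrite lee_fin size_ek_cells factS natrM invfM mulrCA divff ?mulr1 ?ltW //.
Qed.

(** An interior point would put a ball, of positive measure, inside the null set. *)
Lemma null_closed_nowhere_dense (R : realType) (A : set R) :
  closed A -> lebesgue_measure A = 0%E -> nowhere_dense A.
Proof.
move=> cA A0; rewrite /nowhere_dense -(closure_id A).1 //.
apply/seteqP; split=> // x /nbhs_ballP[e /= e0 xA].
have : (lebesgue_measure (ball x e) <= lebesgue_measure A)%E.
  apply: (@le_measure _ R _ (@lebesgue_measure R)) => //; rewrite inE.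
    exact: measurable_realfun.measurable_ball.
  exact: measurable_realfun.closed_measurable.
rewrite A0 (lebesgue_measure_ball _ (ltW e0)) leNgt => /negP; apply.
by apply: mulrn_wgt0.
Qed.

Lemma meager_erdos_kakutani (R : realType) : meager (@erdos_kakutani R).
Proof.
exists [set @erdos_kakutani R]; split; first exact: countable1.
  move=> _ ->; apply: null_closed_nowhere_dense.
    exact: closed_erdos_kakutani.
  exact: null_erdos_kakutani.
by rewrite bigcup_set1.
Qed.

(** * Uniform continuity on the Cantor space *)

Lemma near_cantor_coord (z : cantor_space) (i : nat) :
  \forall z' \near z, z' i = z i.
Proof.
apply: (@proj_continuous nat (fun=> bool) i z [set b | b = z i]).
exact: (@discrete_set1 bool (z i)).
Qed.

(* The compact set of pairs on which [f] moves by at least [d] misses the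
   diagonal, so by compactness a bounded number of coordinates separates all
   of its pairs. *)
Lemma cantor_modulus (R : realType) (f : cantor_space -> R) (d : R) :
  continuous f -> 0 < d ->
  exists n : nat, forall z z' : cantor_space,
    (forall i, (i < n)%N -> z i = z' i) -> `|f z - f z'| < d.
Proof.
move=> fc d0.
pose A := [set p : cantor_space * cantor_space | d <= `|f p.1 - f p.2|].
have cA : compact A.
  have cT : compact [set: cantor_space * cantor_space].
    by rewrite -setXTT; apply: compact_setX; exact: cantor_space_compact.
  apply: subclosed_compact cT _ => //.
  apply: (@preimage_closed _ _ _ [set r | d <= r]); last exact: closed_ge.
  move=> p _; apply: cvg_norm; apply: cvgB.
    by apply: continuous_comp; [exact: cvg_fst|exact: fc].
  by apply: continuous_comp; [exact: cvg_snd|exact: fc].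
have [n _ nA] : \forall n \near \oo,
    A `<=` (fun p => exists2 i, (i < n)%N & p.1 i != p.2 i).
  apply: ((compact_near_coveringP A).1 cA nat \oo
    (fun n p => exists2 i, (i < n)%N & p.1 i != p.2 i)).
  move=> [z z'] /= Azz'.
  have [i zz'] : exists i, z i != z' i.
    apply: contrapT => /forallNP zz'; suff E : z = z'.
      by move: Azz'; rewrite /A /= E subrr normr0 leNgt d0.
    by apply/funext => i; apply/eqP/negP => /negP; exact: zz'.
  exists ([set p | p.1 i = z i /\ p.2 i = z' i], [set n | (i < n)%N]) => /=.
    split; last by exists i.+1.
    exists ([set w | w i = z i], [set w | w i = z' i]) => //=.
    by split; exact: near_cantor_coord.
  by move=> [[w w'] n] /= [[E1 E2] lin]; exists i => //; rewrite /= E1 E2.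
exists n => z z' zz'; rewrite ltNge; apply/negP => dzz'.
have [i /zz' zi] := nA n (leqnn n) (z, z') dzz'.
by rewrite /= zi eqxx.
Qed.

(** * Digit criterion for membership *)

Lemma sub_grid_ek_cellsS (R : realType) (k : nat) :
  grid_cells ((k.+2)`!%:R : R) (ek_cells k.+1) `<=`
  grid_cells ((k.+1)`!%:R : R) (ek_cells k).
Proof.
move=> y [b /allpairsP[[a j] [ak]]].
rewrite mem_iota add0n factS natrM -mulrA /= => jk -> /andP[h1 h2].
exists a => //; have k0 : 0 < k.+2%:R :> R by rewrite ltr0n.
rewrite -(ler_pM2l k0) -[X in _ && X](ler_pM2l k0) -!natrM; apply/andP; split.
  by apply: le_trans h1; rewrite ler_nat; lia.
by apply: le_trans h2 _; rewrite ler_nat; lia.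
Qed.

(** The two inequalities force [q] to be the integer part of (k+1)! y, which is [a], and then say
    that the next digit is at most [k]. *)
Lemma ek_cells_descend (R : realType) (k a : nat) (y : R) :
  a \in ek_cells k -> a%:R <= (k.+1)`!%:R * y < a.+1%:R ->
  (exists q : int, q%:~R <= (k.+1)`!%:R * y /\
     (k.+2)`!%:R * y < k.+2%:R * q%:~R + k.+1%:R) ->
  exists2 b : nat, b \in ek_cells k.+1 &
    b%:R <= (k.+2)`!%:R * y < b.+1%:R.
Proof.
move=> ak; rewrite (factS k.+1) natrM -mulrA.
set Y := _ * y => /andP[aY Ya] [q [qY Yq]].
have k0 : 0 < k.+2%:R :> R by rewrite ltr0n.
have qa : q = a%:Z.
  apply/eqP; rewrite eq_le; apply/andP; split.
    rewrite -ltzD1 -(ltr_int R) intrD -pmulrn mulr1z natr1.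
    exact: le_lt_trans qY Ya.
  rewrite -ltzD1 -(ltr_int R); apply: le_lt_trans aY _.
  rewrite -(ltr_pM2l k0) intrD mulrDr mulr1; apply: lt_trans Yq _.
  by rewrite ltrD2l ltr_nat.
have /andP[] := floor_itv (k.+2%:R * Y); set f := Num.floor _ => f1 f2.
have af : (k.+2 * a)%N%:Z <= f.
  by rewrite floor_ge_int -pmulrn natrM ler_pM2l.
have fa : f < (k.+2 * a)%N%:Z + k.+1%:Z.
  by rewrite floor_lt_int intrD -!pmulrn natrM; move: Yq; rewrite qa.
have fE : f = (k.+2 * a + `|f - (k.+2 * a)%N%:Z|)%N%:Z by lia.
exists (k.+2 * a + `|f - (k.+2 * a)%N%:Z|)%N.
  by apply: mem_ek_cells => //; lia.
move: f1 f2; rewrite {1 2}fE intrD mulr1z -pmulrn natr1.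
by move=> -> ->.
Qed.

Lemma erdos_kakutani_digits (R : realType) (k0 a : nat) (y : R) :
  a \in ek_cells k0 -> a%:R <= (k0.+1)`!%:R * y < a.+1%:R ->
  (forall k, (k0 <= k)%N -> exists q : int, q%:~R <= (k.+1)`!%:R * y /\
     (k.+2)`!%:R * y < k.+2%:R * q%:~R + k.+1%:R) ->
  erdos_kakutani y.
Proof.
move=> ak ya yd.
have up i : exists2 b : nat, b \in ek_cells (k0 + i)%N &
    b%:R <= (k0 + i).+1`!%:R * y < b.+1%:R.
  elim: i => [|i [b bk yb]]; first by exists a; rewrite addn0.
  rewrite addnS; apply: ek_cells_descend bk yb _; apply: yd; exact: leq_addr.
have upK i : grid_cells ((k0 + i).+1`!%:R) (ek_cells (k0 + i)%N) y.
  by have [b bk /andP[yb /ltW yb']] := up i; exists b; rewrite ?yb.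
(* From level [k + k0], nesting of the cells leads back to level [k]; this also settles the levels
   below [k0]. *)
move=> k _; have := upK k; rewrite addnC.
elim: k0 {ak ya yd up upK} => [|n IH]; first by rewrite addn0.
by rewrite addnS => /sub_grid_ek_cellsS/IH.
Qed.

(** * Translating a clustered set into the Erdős-Kakutani set *)

(* Each [u] excludes [c] values of [j] modulo [m]. *)
Lemma avoid_large_residues (m c : nat) (U : seq int) :
  (c * size U < m)%N ->
  exists2 j : nat, (j < m)%N &
    forall u, u \in U -> ((u + j%:Z) %% m%:Z)%Z + c%:Z < m%:Z.
Proof.
move=> Um; apply: contrapT => noj.
(* Pigeonhole: a [j] spoiled by [u] is congruent to [m - 1 - i - u] for some [i < c], so fewer than
   [m] values are spoiled. *)
pose bad :=
  [seq absz ((m%:Z - 1 - i%:Z - u) %% m%:Z)%Z | u <- U, i <- iota 0 c].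
have : (size (iota 0 m) <= size bad)%N.
  apply: uniq_leq_size; first exact: iota_uniq.
  move=> j; rewrite mem_iota add0n /= => jm.
  have [u uU uj] : exists2 u, u \in U & m%:Z <= ((u + j%:Z) %% m%:Z)%Z + c%:Z.
    apply: contrapT => nou; apply: noj; exists j => // u uU.
    by rewrite ltNge; apply/negP => h; apply: nou; exists u.
  have m0 : (m%:Z != 0) by lia.
  have h0 := modz_ge0 (u + j%:Z) m0.
  have h1 : ((u + j%:Z) %% m%:Z)%Z < m%:Z by apply: ltz_pmod; lia.
  pose i := absz (m%:Z - 1 - ((u + j%:Z) %% m%:Z)%Z)%R.
  have iE : i%:Z = m%:Z - 1 - ((u + j%:Z) %% m%:Z)%Z.
    by rewrite /i gez0_abs; lia.
  apply/allpairsP; exists (u, i); split => //=.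
    by rewrite mem_iota add0n; move: iE uj h1; set r := (_ %% _)%Z; lia.
  have jm' : 0 <= j%:Z < m%:Z by rewrite ltz_nat.
  have -> : m%:Z - 1 - i%:Z - u = ((u + j%:Z) %% m%:Z)%Z - u.
    by rewrite iE; ring.
  by rewrite modzDml addrAC subrr add0r modz_small.
by rewrite size_iota size_allpairs size_iota mulnC leqNgt Um.
Qed.

Lemma nested_intervals (R : realType) (x y : nat -> R) :
  (forall i, x i <= x i.+1) -> (forall i, y i.+1 <= y i) ->
  (forall i, x i <= y i) -> exists t, forall i, x i <= t <= y i.
Proof.
move=> xS yS xy.
have xm : {homo x : i j / (i <= j)%N >-> i <= j}.
  by apply: homo_leq => //; exact: le_trans.
have ym : {homo y : i j / (i <= j)%N >-> j <= i}.
  by apply: homo_leq => // b a c ab bc; exact: le_trans bc ab.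
have xym i j : x i <= y j.
  apply: le_trans (xm _ _ (leq_maxl i j)) (le_trans (xy _) _).
  exact: ym (leq_maxr i j).
exists (sup (range x)) => i; apply/andP; split.
  by apply: ub_le_sup; [exists (y 0%N) => _ [j _ <-]|exists i].
by apply: ge_sup; [exists (x 0%N); exists 0%N|move=> _ [j _ <-]].
Qed.

(* [U k] lists windows [u, u + 3) that together contain the range of [h] at
   scale [1 / (k+2)!].  The translation [t] is built digit by digit: once it is
   known up to [1 / (k+2)!], each window for [h z] becomes a window of length 4
   for [h z + t], and its digit is chosen so that none of these windows meets
   the forbidden digit [k+1]. *)
Lemma translate_into_erdos_kakutani (R : realType) (Z : Type) (h : Z -> R)
    (k0 a : nat) (U : nat -> seq int) :
  (2 < k0)%N -> a \in ek_cells k0 ->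
  (forall k, (k0 <= k)%N -> forall z, exists2 u : int, u \in U k &
     u%:~R <= (k.+2)`!%:R * h z < (u + 3)%:~R) ->
  size (U k0) = 1%N ->
  (forall k, (k0 < k)%N -> (4 * size (U k) < k.+2)%N) ->
  exists t : R, forall z, erdos_kakutani (h z + t) /\
    a%:R <= (k0.+1)`!%:R * (h z + t) < a.+1%:R.
Proof.
move=> k02 ak Uh U1 U4.
have [u0 U0] : exists u0, U k0 = [:: u0].
  by case: (U k0) U1 => [|u [|]] // _; exists u.
have /choice[J JP] : forall k, exists j : nat, (k0 < k)%N ->
    (j < k.+2)%N /\
    forall u, u \in U k -> ((u + j%:Z) %% k.+2%:Z)%Z + 4 < k.+2%:Z.
  move=> k; have [kk|?] := ltnP k0 k; last by exists 0%N.
  by have [j jk jU] := avoid_large_residues (U4 k kk); exists j.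
(* In units of 1 / (k0+i+2)!, [t] will lie between [T i] and [T i + 1]. The initial value moves the
   single window of step [k0] to the left end of cell [a]. *)
pose T := fix T i : int := if i is i'.+1
  then (k0 + i'.+1).+2%:Z * T i' + (J (k0 + i'.+1)%N)%:Z
  else a%:Z * k0.+2%:Z - u0.
pose F i : R := (k0 + i).+2`!%:R.
have F0 i : 0 < F i by exact: fact_gt0r.
have FS i : F i.+1 = (k0 + i.+1).+2%:R * F i.
  by rewrite /F addnS factS natrM.
have TS i : T i.+1 = (k0 + i.+1).+2%:Z * T i + (J (k0 + i.+1)%N)%:Z by [].
have JS i : (J (k0 + i.+1) < (k0 + i.+1).+2)%N.
  by have [|] := JP (k0 + i.+1)%N; first lia.
have [t tP] : exists t, forall i, (T i)%:~R / F i <= t <= (T i + 1)%:~R / F i.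
  apply: nested_intervals => i.
  - rewrite ler_pdivrMr // mulrAC ler_pdivlMr // FS mulrA ler_pM2r //.
    by rewrite [_.+2%:R]pmulrn -intrM ler_int TS; lia.
  - rewrite ler_pdivrMr // mulrAC ler_pdivlMr // FS mulrA ler_pM2r //.
    by rewrite [_.+2%:R]pmulrn -intrM ler_int TS; have := JS i; lia.
  by rewrite ler_pM2r ?invr_gt0 // ler_int; lia.
exists t => z.
have win i : exists2 u, u \in U (k0 + i)%N &
    (u + T i)%:~R <= F i * (h z + t) < (u + T i + 4)%:~R.
  have [u uU /andP[uh hu]] := Uh _ (leq_addr i k0) z; exists u => //.
  have /andP[] := tP i; rewrite ler_pdivrMr // ler_pdivlMr // => Tt tT.
  move: uh hu; rewrite -/(F i) => uh hu.
  rewrite mulrDr [F i * t]mulrC !intrD in hu tT *.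
  by apply/andP; split; lra.
have digit k : (k0 <= k)%N -> exists q : int,
    q%:~R <= (k.+1)`!%:R * (h z + t) /\
    (k.+2)`!%:R * (h z + t) < k.+2%:R * q%:~R + k.+1%:R.
  move=> kk; have [i ->] : exists i, k = (k0 + i)%N by exists (k - k0)%N; lia.
  have [u uU /andP[w1 w2]] := win i.
  suff [q [q1 q2]] : exists q : int, (k0 + i).+2%:Z * q <= u + T i /\
      u + T i + 4 <= (k0 + i).+2%:Z * q + (k0 + i).+1%:Z.
    exists q; split.
      have k2 : 0 < (k0 + i).+2%:R :> R by rewrite ltr0n.
      rewrite -(ler_pM2l k2) mulrA -natrM -factS pmulrn -intrM.
      by apply: le_trans w1; rewrite ler_int.
    apply: lt_le_trans w2 _.
    by rewrite !pmulrn -intrM -intrD ler_int.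
  case: i uU {w1 w2} => [|i] uU.
    (* The first window starts at [(k0+2) a] and has length 4, which is at most [k0 + 1] as
       [2 < k0]. *)
    exists a%:Z; rewrite addn0 U0 inE in uU *; rewrite (eqP uU) /=; lia.
  have [|_ /(_ u uU) Ju] := JP (k0 + i.+1)%N; first lia.
  set m := (k0 + i.+1).+2 in Ju *.
  (* Since [T i.+1] is [m * T i] plus the new digit [J], the window starts at residue [r] modulo
     [m], and [r + 4 < m] keeps it off the last digit. *)
  have := divz_eq (u + (J (k0 + i.+1)%N)%:Z) m%:Z.
  set r := (_ %% _)%Z in Ju *; set q := (_ %/ _)%Z => qE.
  have r0 : 0 <= r by apply: modz_ge0.
  by exists (q + T i); rewrite TS -/m; split; nia.
have cell : a%:R <= (k0.+1)`!%:R * (h z + t) < a.+1%:R.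
  have [u + /andP[w1 w2]] := win 0%N; rewrite addn0 U0 inE => /eqP uE.
  move: w1 w2; rewrite uE /= subrKC /F addn0 factS natrM -mulrA.
  set Y := _ * (h z + t) => w1 w2.
  have k2 : 0 < k0.+2%:R :> R by rewrite ltr0n.
  apply/andP; split; rewrite -(ler_pM2l k2, ltr_pM2l k2).
    by apply: le_trans w1; rewrite intrM -!pmulrn mulrC.
  apply: lt_le_trans w2 _; rewrite -natrM [leRHS]pmulrn ler_int; nia.
split=> //; exact: erdos_kakutani_digits ak cell digit.
Qed.

(** * Sparse Cantor subsets *)

(** Embeds bit sequences as points supported on the positions [p]; the search up to [q] misses
    nothing once [i <= p i]. *)
Definition spread (p : nat -> nat) (z : nat -> bool) : cantor_space :=
  fun q => has (fun i => (p i == q) && z i) (iota 0 q.+1).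

Lemma spreadE (p : nat -> nat) (z : nat -> bool) (i : nat) :
  injective p -> (i <= p i)%N -> spread p z (p i) = z i.
Proof.
move=> pI ip; apply/hasP/idP => [[j _ /andP[/eqP/pI -> //]]|zi].
by exists i; rewrite ?eqxx // mem_iota.
Qed.

Lemma eq_spread (p : nat -> nat) (z z' : nat -> bool) (n N : nat) :
  (forall i, (i < n)%N -> z i = z' i) ->
  (forall i, (n <= i)%N -> (N <= p i)%N) ->
  forall q, (q < N)%N -> spread p z q = spread p z' q.
Proof.
move=> zz' pN q qN; apply: eq_has => i; have [pi|//] := eqVneq (p i) q.
have [/zz' -> //|/pN] := ltnP i n; lia.
Qed.

(** [h] is [f] after [spread]: at each scale the visible bits fix the value up to one unit, so one
    window per bit pattern suffices. *)
Lemma sparse_cantor_clusters (R : realType) (f : cantor_space -> R) (k0 : nat) :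
  (2 < k0)%N -> continuous f -> injective f ->
  exists h : (nat -> bool) -> R, exists U : nat -> seq int,
    [/\ injective h, range h `<=` range f,
        (forall k, (k0 <= k)%N -> forall z, exists2 u : int, u \in U k &
          u%:~R <= (k.+2)`!%:R * h z < (u + 3)%:~R),
        size (U k0) = 1%N &
        forall k, (k0 < k)%N -> (4 * size (U k) < k.+2)%N].
Proof.
move=> k02 fc fI.
have /choice[e eP] : forall k, exists n : nat, forall z z' : cantor_space,
    (forall i, (i < n)%N -> z i = z' i) -> `|f z - f z'| < ((k.+2)`!%:R)^-1.
  by move=> k; apply: cantor_modulus => //; rewrite invr_gt0 fact_gt0r.
(* Bit [i] is placed beyond every modulus [e k] with [k < M i], so at scale
   [1 / (k+2)!] only the few bits with [M i <= k] are visible. *)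
pose M i := (k0.+1 + 2 ^ (i + 3))%N.
pose p i := (i + \sum_(k < M i) e k)%N.
have MS i j : (i <= j)%N -> (M i <= M j)%N.
  by move=> ij; rewrite leq_add2l leq_exp2l // leq_add2r.
have ep k i : (k < M i)%N -> (e k <= p i)%N.
  by move=> kM; rewrite /p (bigD1 (Ordinal kM)) //=; lia.
have pI : injective p.
  have pm i j : (i < j)%N -> (p i < p j)%N.
    move=> ij; rewrite /p -addSn leq_add //.
    rewrite -!(big_mkord xpredT e) [leqRHS](big_cat_nat _ (n := M i)) //=.
      exact: leq_addr.
    exact/MS/ltnW.
  by move=> i j pij; have [/pm|/pm|//] := ltngtP i j; lia.
(* [n] is the number of visible bits. The summand [k0.+1] of [M] leaves none at step [k0]; if [n] is
   positive, visibility of bit [n - 1] gives 2^(n+2) < k, that is, 4 * 2^n < k. *)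
have /choice[n nP] : forall k, exists n : nat,
    [/\ (forall i, (n <= i)%N -> (k < M i)%N), k = k0 -> n = 0%N &
        (k0 < k)%N -> (4 * 2 ^ n < k.+2)%N].
  move=> k; have exM : exists i, (k < M i)%N.
    exists k; have := ltn_expl (k + 3) (isT : 1 < 2)%N; rewrite /M; lia.
  exists (ex_minn exM); case: ex_minnP => m km mmin; split.
  - by move=> i mi; exact: leq_trans km (MS _ _ mi).
  - by move=> kk; apply/eqP; rewrite -leqn0; apply: mmin; rewrite /M kk; lia.
  - case: m km mmin => [|m] km mmin; first lia.
    have : ~~ (k < M m)%N by apply/negP => /mmin; rewrite ltnn.
    rewrite /M -leqNgt addn3 !expnS; lia.
pose h z := f (spread p z).
(* Values with the same visible bits differ by less than one unit, so a window of length 3 starting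
   one below the floor catches them all. *)
pose U k := [seq Num.floor ((k.+2)`!%:R * h (nth false b)) - 1 |
  b <- map val (enum {: (n k).-tuple bool})].
have sU k : size (U k) = (2 ^ n k)%N.
  by rewrite /U 2!size_map -cardT card_tuple card_bool.
exists h, U; split.
- move=> z z' /fI hz; apply/funext => i.
  have ip : (i <= p i)%N by exact: leq_addr.
  by rewrite -(spreadE z pI ip) -(spreadE z' pI ip) hz.
- by move=> _ [z _ <-]; exists (spread p z).
- move=> k kk z; have [nk _ _] := nP k.
  pose b := [tuple z (val i) | i < n k].
  exists (Num.floor ((k.+2)`!%:R * h (nth false b)) - 1).
    by apply/mapP; exists (val b) => //; apply: map_f; rewrite mem_enum.
  have zb i : (i < n k)%N -> z i = nth false b i.
    by move=> ik; rewrite -[i]/(val (Ordinal ik)) -tnth_nth tnth_mktuple.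
  have := eP k _ _ (eq_spread zb (fun i ni => ep k i (nk i ni))).
  rewrite -/(h z) -/(h (nth false b)) -[_^-1]mul1r ltr_pdivlMr ?fact_gt0r //.
  set N := _`!%:R; have N0 : 0 < N by exact: fact_gt0r.
  rewrite -{1}(gtr0_norm N0) -normrM ltr_norml mulrBl ![_ * N]mulrC.
  move=> /andP[h1 h2].
  have /andP[] := floor_itv (N * h (nth false b)).
  rewrite !intrD; set w := (Num.floor _)%:~R => w1 w2.
  by apply/andP; split; lra.
- by rewrite sU; have [_ -> //] := nP k0.
- by move=> k kk; rewrite sU; have [_ _ ->] := nP k.
Qed.

(** * Portions are not Haar-countable *)

(** Cantor's diagonal argument: [D], evaluated at its own code [g (h D)], is contradictory. *)
Lemma not_countable_range (T : Type) (h : (nat -> bool) -> T) (A : set T) :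
  injective h -> range h `<=` A -> ~ countable A.
Proof.
move=> hI hA /countable_injP[g gI].
have hAz z : h z \in A by apply/mem_set/hA; exists z.
have ghI z z' : g (h z) = g (h z') -> z = z' by move=> E; apply/hI/gI.
pose D n := `[< exists2 z, g (h z) = n & z n = false >].
case DE: (D (g (h D))).
  by move/asboolP: (DE) => [z /ghI ->]; rewrite DE.
by move/asboolP: (DE); apply; exists D.
Qed.

Lemma portion_erdos_kakutani_not_haar_countable (R : realType) (F : set R)
    (x r : R) :
  0 < r -> erdos_kakutani x -> @erdos_kakutani R `&` ball x r `<=` F ->
  ~ haar_countable F.
Proof.
move=> r0 xK KF [B [C [_ FB [f [g [fc _ fC fg]]] CB]]].
have [n] := ltr_add_invr r0; rewrite add0r => nr.
(* At this scale a cell has length at most 1 / (n+1), hence below [r]; the [+ 3] ensures [2 < k]. *)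
pose k := (n + 3)%N.
have k2 : (2 < k)%N by rewrite /k; lia.
have [a ak xa] := xK k I.
have [h [U [hI hf hU U1 U4]]] := sparse_cantor_clusters k2 fc (can_inj fg).
have [t tP] := translate_into_erdos_kakutani k2 ak hU U1 U4.
have htI : injective (fun z => h z + t) by move=> z z' /addIr/hI.
apply: not_countable_range htI _ (CB t) => _ [z _ <-]; split.
  by exists (h z) => //; rewrite -fC; apply: hf; exists z.
apply/FB/KF; have [hK /andP[ah ha]] := tP z; split=> //.
rewrite -ball_normE /=; apply: le_lt_trans nr.
set N := (_`!)%:R in xa ah ha; have N0 : 0 < N by exact: fact_gt0r.
have nN : n.+1%:R <= N.
  by rewrite ler_nat; apply: leq_trans (fact_geq _); rewrite /k; lia.
apply: (@le_trans _ _ N^-1); last by rewrite lef_pV2 ?posrE.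
rewrite -[N^-1]mul1r ler_pdivlMr // -{1}(gtr0_norm N0) -normrM ler_norml.
case/andP: xa => ax xa; rewrite mulrBl ![_ * N]mulrC.
by rewrite -natr1 in xa ha; apply/andP; split; lra.
Qed.

(** * Baire category and conclusion *)

(** If no [F i] contained a portion, regularity would give open sets [V n] meeting [K], with the
    closure of [V n.+1] inside [V n] and off [F n]. *)
Lemma compact_countable_closed_cover (T : topologicalType) (K : set T)
    (F : nat -> set T) :
  regular_space T -> compact K -> K !=set0 -> (forall i, closed (F i)) ->
  K `<=` \bigcup_i F i ->
  exists i V, [/\ open V, K `&` V !=set0 & K `&` V `<=` F i].
Proof.
move=> regT cK K0 cF KF; apply: contrapT => noV.
have /choice[s sP] : forall p : nat * set T, exists W : set T,
    open p.2 -> K `&` p.2 !=set0 ->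
    [/\ open W, K `&` W !=set0 & closure W `<=` p.2 `\` F p.1].
  move=> [i V] /=.
  have [[oV KV]|nV] := pselect (open V /\ K `&` V !=set0); last first.
    by exists set0 => oV KV; case: nV.
  have [y [[Ky Vy] Fy]] : exists y, (K `&` V) y /\ ~ F i y.
    apply: contrapT => noy; apply: noV; exists i, V; split=> // y KVy.
    by apply: contrapT => Fy; apply: noy; exists y.
  have [|W Wy WV] := regT y (V `\` F i).
    apply: open_nbhs_nbhs; split=> //; apply: openI => //.
    exact: closed_openC.
  exists W° => _ _; split; first exact: open_interior.
    by exists y; split.
  by apply: subset_trans WV; apply: closure_subset; exact: interior_subset.
pose V := fix V n := if n is n'.+1 then s (n', V n') else [set: T].
have VP n : open (V n) /\ K `&` V n !=set0.
  elim: n => [|n [oV KV]]; first by rewrite setIT; split => //; exact: openT.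
  by have [] := sP (n, V n) oV KV.
have VS n : closure (V n.+1) `<=` V n `\` F n.
  by have [oV KV] := VP n; have [] := sP (n, V n) oV KV.
have Vm i j : (i <= j)%N -> V j `<=` V i.
  move=> /subnKC <-; elim: (j - i)%N => [|d IH]; first by rewrite addn0.
  by rewrite addnS => y Vy; apply/IH/(VS _ _ _).1/subset_closure.
(* A point of [K] in [F i] lies outside the closure of [V i.+1]; by compactness a single closure
   misses all of [K]. *)
have [n _ nV] : \forall n \near \oo, K `<=` (fun y => ~ closure (V n) y).
  apply: ((compact_near_coveringP K).1 cK nat \oo
    (fun n y => ~ closure (V n) y)) => x /KF[i _ Fx].
  exists (~` closure (V i.+1), [set n | (i.+1 <= n)%N]) => /=.
    split; last by exists i.+1.
    apply: open_nbhs_nbhs; split; first exact/closed_openC/closed_closure.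
    by move=> /VS[].
  by move=> [y n] /= [Vy ni] /(closure_subset (Vm _ _ ni)).
have [_ [y [Ky Vy]]] := VP n.
exact: nV n (leqnn n) y Ky (subset_closure Vy).
Qed.

Lemma erdos_kakutani0 (R : realType) : erdos_kakutani (0 : R).
Proof.
move=> k _; exists 0%N; last by rewrite mulr0 lexx ler01.
elim: k => // k IH.
by rewrite -[0%N](muln0 k.+2) -[(_ * _)%N]addn0 mem_ek_cells.
Qed.

Theorem corollary7p3 (R : realType) :
  exists K : set R,
    [/\ compact K,
        lebesgue_measure K = 0%E,
        meager K,
        ~ countable_union_of [set F | closed F /\ haar_countable F] K &
        ~ countable_cover_by [set F | closed F /\ haar_countable F] K].
Proof.
have cK := @compact_erdos_kakutani R.
have nocover : ~ countable_cover_by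
    [set F | closed F /\ haar_countable F] (@erdos_kakutani R).
  move=> [FF [/countable_injP[g gI] FFP KFF]].
  (* The family is enumerated through its codes [g]; a number that codes no member gets [set0],
     which is closed and contains no nonempty portion. *)
  pose F i := xget set0 [set X | FF X /\ g X = i].
  have [|||i [V [oV [x [xK Vx]] KV]]] :=
      @compact_countable_closed_cover _ _ F (@uniform_regular R) cK.
  - by exists 0; exact: erdos_kakutani0.
  - move=> i; rewrite /F; case: xgetP => [X _ [/FFP[] //]|_].
    exact: closed0.
  - move=> x /KFF[X FX Xx]; exists (g X) => //; rewrite /F.
    case: xgetP => [Y _ [FY gXY]|/(_ X)]; last by case.
    by rewrite (gI _ _ _ _ gXY) ?inE.
  have [r /= r0 rV] := (nbhs_ballP _ _).1 (open_nbhs_nbhs (conj oV Vx)).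
  have KF : @erdos_kakutani R `&` ball x r `<=` F i.
    by move=> y [yK yr]; apply: KV; split => //; exact: rV.
  move: KF; rewrite /F; case: xgetP => [X _ [/FFP[_ hX] _] KX|_ K0].
    exact: portion_erdos_kakutani_not_haar_countable r0 xK KX hX.
  by apply: (K0 x); split => //; exact: ballxx.
exists (@erdos_kakutani R); split=> //.
- exact: null_erdos_kakutani.
- exact: meager_erdos_kakutani.
- move=> [FF [cFF FFP KE]]; apply: nocover; exists FF; split=> //.
  by rewrite -KE.
Qed.
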